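(* Let $S$ be a subtractive semidomain. Then $S$ is a Dedekind semidomain if and only if the following two conditions hold: (1) Every nonzero prime ideal in $S$ is invertible. (2) $S$ is a $\pi$-semiring.
   Context: A semiring is $(S,+,\cdot,0,1)$ where $(S,+,0)$ and $(S,\cdot,1)$ are commutative monoids, $1\neq 0$, multiplication distributes over addition, and $a\cdot 0=0$ for all $a$. A semidomain is a semiring $S$ in which $ab=ac$ with $a\neq 0$ implies $b=c$. Its semifield of fractions $K=F(S)$ is the localization of $S$ at $S-\{0\}$. An ideal of $S$ is a nonempty subset closed under addition and under multiplication by elements of $S$. An ideal $I$ is subtractive if $a+b\in I$ and $a\in I$ imply $b\in I$ for all $a,b\in S$; a semiring is subtractive if each of its ideals is subtractive. A prime ideal is a proper ideal $\mathfrak{p}$ such that $ab\in\mathfrak{p}$ implies $a\in\mathfrak{p}$ or $b\in\mathfrak{p}$. A fractional ideal of $S$ is a nonempty subset $A\subseteq K$ closed under addition and under multiplication by elements of $S$ such that $dA\subseteq S$ for some nonzero $d\in S$. The product of (fractional) ideals $A,B$ is $AB=\{\sum_{i=1}^n a_ib_i: a_i\in A, b_i\in B\}$, and $A$ is invertible if $AB=S$ for some fractional ideal $B$. A Dedekind semidomain is a semidomain in which each nonzero fractional ideal is invertible. A semiring $S$ is a $\pi$-semiring if each nonzero proper principal ideal of $S$ is a product of prime ideals of $S$. *)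

(* Defs.v *)
From HB Require Import structures.
From mathcomp Require Import all_boot all_order all_algebra.
From mathcomp Require Import generic_quotient ring.
From mathcomp Require Import boolp classical_sets.

Set Implicit Arguments.
Unset Strict Implicit.
Unset Printing Implicit Defensive.

Import GRing.Theory.
Local Open Scope quotient_scope.
Local Open Scope classical_set_scope.
Local Open Scope ring_scope.

HB.mixin Record ComNzSemiRing_isSemidomain S of GRing.ComNzSemiRing S := {
  semidomain_mulfI : forall a b c : S, a != 0 -> a * b = a * c -> b = c
}.

#[short(type="semidomainType")]
HB.structure Definition Semidomain :=
  {S of GRing.ComNzSemiRing S & ComNzSemiRing_isSemidomain S}.

Lemma semidomain_mulf_neq0 (S : semidomainType) (a b : S) :
  a != 0 -> b != 0 -> a * b != 0.
Proof.
move=> a0; apply: contra_neq => ab0.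
by apply: (semidomain_mulfI a _ _ a0); rewrite ab0 mulr0.
Qed.

(* mathcomp's fraction.v needs an integral domain (with subtraction), so the
   localization of S at S - {0} is built here along the same lines. *)
Section Semifrac.
Variable S : semidomainType.

Record semiratio := Semiratio { semiratio_val : S * S; _ : semiratio_val.2 != 0 }.
HB.instance Definition _ := [isSub for semiratio_val].
HB.instance Definition _ := [Choice of semiratio by <:].

Definition sfnum (x : semiratio) : S := (semiratio_val x).1.
Definition sfden (x : semiratio) : S := (semiratio_val x).2.

Lemma sfden_neq0 x : sfden x != 0. Proof. by case: x. Qed.

(* In the localization, a/b = c/d means u * (a * d) = u * (c * b) for some
   u != 0; by cancellation this is a * d = c * b. *)
Definition sfequiv (x y : semiratio) : bool :=
  sfnum x * sfden y == sfnum y * sfden x.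

Lemma sfequiv_refl : reflexive sfequiv.
Proof. by move=> x; rewrite /sfequiv. Qed.

Lemma sfequiv_sym : symmetric sfequiv.
Proof. by move=> x y; rewrite /sfequiv eq_sym. Qed.

Lemma sfequiv_trans : transitive sfequiv.
Proof.
move=> y x z /eqP xy /eqP yz; apply/eqP/(semidomain_mulfI _ _ _ (sfden_neq0 y)).
rewrite mulrA [sfden y * _]mulrC xy mulrAC yz; ring.
Qed.

Canonical sfequiv_rel := EquivRel sfequiv sfequiv_refl sfequiv_sym sfequiv_trans.

Definition semifrac := {eq_quot sfequiv}.
HB.instance Definition _ : EqQuotient _ sfequiv semifrac := EqQuotient.on semifrac.
HB.instance Definition _ := Choice.on semifrac.

Lemma semifrac_piP (x y : semiratio) :
  (\pi_semifrac x = \pi_semifrac y) <-> sfnum x * sfden y = sfnum y * sfden x.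
Proof. by split=> [/eqmodP/eqP | /eqP xy]; last exact/eqmodP. Qed.

Lemma semifrac_reprP (x : semiratio) :
  sfnum (repr (\pi_semifrac x)) * sfden x = sfnum x * sfden (repr (\pi_semifrac x)).
Proof. by apply/semifrac_piP; rewrite reprK. Qed.

Definition mk_semiratio (a b : S) (b0 : b != 0) : semiratio := @Semiratio (a, b) b0.

Definition tosemifrac (a : S) : semifrac := \pi_semifrac (mk_semiratio a (oner_neq0 S)).

Definition sfaddf (x y : semiratio) : semiratio :=
  mk_semiratio (sfnum x * sfden y + sfnum y * sfden x)
     (semidomain_mulf_neq0 (sfden_neq0 x) (sfden_neq0 y)).
Definition sfmulf (x y : semiratio) : semiratio :=
  mk_semiratio (sfnum x * sfnum y) (semidomain_mulf_neq0 (sfden_neq0 x) (sfden_neq0 y)).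

Definition sfadd := lift_op2 semifrac sfaddf.
Definition sfmul := lift_op2 semifrac sfmulf.

Lemma pi_sfadd x y : sfadd (\pi_semifrac x) (\pi_semifrac y) = \pi_semifrac (sfaddf x y).
Proof.
unlock sfadd; apply/semifrac_piP; rewrite /sfaddf /sfnum /sfden /= -/(sfnum _) -/(sfden _).
set x' := repr _; set y' := repr _.
have hx : sfnum x' * sfden x = sfnum x * sfden x' := semifrac_reprP x.
have hy : sfnum y' * sfden y = sfnum y * sfden y' := semifrac_reprP y.
transitivity ((sfnum x' * sfden x) * (sfden y' * sfden y)
              + (sfnum y' * sfden y) * (sfden x' * sfden x)).
  by rewrite /sfnum /sfden; ring.
by rewrite hx hy /sfnum /sfden; ring.
Qed.

Lemma pi_sfmul x y : sfmul (\pi_semifrac x) (\pi_semifrac y) = \pi_semifrac (sfmulf x y).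
Proof.
unlock sfmul; apply/semifrac_piP; rewrite /sfmulf /sfnum /sfden /= -/(sfnum _) -/(sfden _).
set x' := repr _; set y' := repr _.
have hx : sfnum x' * sfden x = sfnum x * sfden x' := semifrac_reprP x.
have hy : sfnum y' * sfden y = sfnum y * sfden y' := semifrac_reprP y.
transitivity ((sfnum x' * sfden x) * (sfnum y' * sfden y)).
  by rewrite /sfnum /sfden; ring.
by rewrite hx hy /sfnum /sfden; ring.
Qed.

Lemma sfaddA : associative sfadd.
Proof.
elim/quotW=> x; elim/quotW=> y; elim/quotW=> z; rewrite !pi_sfadd.
by apply/semifrac_piP; rewrite /sfaddf /sfnum /sfden /=; ring.
Qed.

Lemma sfaddC : commutative sfadd.
Proof.
elim/quotW=> x; elim/quotW=> y; rewrite !pi_sfadd.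
by apply/semifrac_piP; rewrite /sfaddf /sfnum /sfden /=; ring.
Qed.

Lemma sfadd0 : left_id (tosemifrac 0) sfadd.
Proof.
elim/quotW=> x; rewrite /tosemifrac pi_sfadd.
by apply/semifrac_piP; rewrite /sfaddf /sfnum /sfden /=; ring.
Qed.

HB.instance Definition _ := GRing.isNmodule.Build semifrac sfaddA sfaddC sfadd0.

Lemma sfmulA : associative sfmul.
Proof.
elim/quotW=> x; elim/quotW=> y; elim/quotW=> z; rewrite !pi_sfmul.
by apply/semifrac_piP; rewrite /sfmulf /sfnum /sfden /=; ring.
Qed.

Lemma sfmulC : commutative sfmul.
Proof.
elim/quotW=> x; elim/quotW=> y; rewrite !pi_sfmul.
by apply/semifrac_piP; rewrite /sfmulf /sfnum /sfden /=; ring.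
Qed.

Lemma sfmul1 : left_id (tosemifrac 1) sfmul.
Proof.
elim/quotW=> x; rewrite /tosemifrac pi_sfmul.
by apply/semifrac_piP; rewrite /sfmulf /sfnum /sfden /=; ring.
Qed.

Lemma sfmulDl : left_distributive sfmul sfadd.
Proof.
elim/quotW=> x; elim/quotW=> y; elim/quotW=> z; rewrite !(pi_sfadd, pi_sfmul).
by apply/semifrac_piP; rewrite /sfaddf /sfmulf /sfnum /sfden /=; ring.
Qed.

Lemma sfmul0 : left_zero (tosemifrac 0) sfmul.
Proof.
elim/quotW=> x; rewrite /tosemifrac pi_sfmul.
by apply/semifrac_piP; rewrite /sfmulf /sfnum /sfden /=; ring.
Qed.

Lemma tosemifrac_inj : injective tosemifrac.
Proof. by move=> a b /semifrac_piP; rewrite /sfnum /sfden /= !mulr1. Qed.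

Lemma sf1_neq0 : tosemifrac 1 != tosemifrac 0.
Proof. by rewrite (inj_eq tosemifrac_inj) oner_neq0. Qed.

HB.instance Definition _ :=
  GRing.Nmodule_isComNzSemiRing.Build semifrac sfmulA sfmulC sfmul1 sfmulDl sfmul0 sf1_neq0.

Lemma tosemifrac_nmod_morphism : nmod_morphism tosemifrac.
Proof.
split=> // a b; rewrite [RHS]pi_sfadd.
by apply/semifrac_piP; rewrite /sfaddf /sfnum /sfden /=; ring.
Qed.

HB.instance Definition _ :=
  GRing.isNmodMorphism.Build S semifrac tosemifrac tosemifrac_nmod_morphism.

Lemma tosemifrac_monoid_morphism : monoid_morphism tosemifrac.
Proof.
split=> // a b; rewrite [RHS]pi_sfmul.
by apply/semifrac_piP; rewrite /sfmulf /sfnum /sfden /=; ring.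
Qed.

HB.instance Definition _ :=
  GRing.isMonoidMorphism.Build S semifrac tosemifrac tosemifrac_monoid_morphism.

Lemma tosemifrac_unit (b : S) : b != 0 -> exists y : semifrac, y * tosemifrac b = 1.
Proof.
move=> b0; exists (\pi_semifrac (mk_semiratio 1 b0)).
rewrite [LHS]pi_sfmul; apply/semifrac_piP.
by rewrite /sfmulf /sfnum /sfden /=; ring.
Qed.

Lemma semifracP (x : semifrac) :
  exists a b : S, b != 0 /\ x * tosemifrac b = tosemifrac a.
Proof.
elim/quotW: x => x; exists (sfnum x), (sfden x); split; first exact: sfden_neq0.
rewrite [LHS]pi_sfmul; apply/semifrac_piP.
by rewrite /sfmulf /sfnum /sfden /=; ring.
Qed.

End Semifrac.

Arguments tosemifrac {S} a.

Notation "{ 'semifrac' S }" := (semifrac S)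
  (format "{ 'semifrac'  S }") : type_scope.

Section Ideals.
Variable S : comNzSemiRingType.
Implicit Types I P : set S.

Definition ideal I : Prop :=
  [/\ I !=set0,
      forall a b, I a -> I b -> I (a + b)
    & forall s a, I a -> I (s * a)].

Definition subtractive_ideal I : Prop :=
  forall a b, I (a + b) -> I a -> I b.

Definition subtractive : Prop := forall I, ideal I -> subtractive_ideal I.

Definition prime_ideal P : Prop :=
  [/\ ideal P, P <> setT & forall a b, P (a * b) -> P a \/ P b].

Definition principal (a : S) : set S := [set s * a | s in setT].

(* The empty sum (n = 0) adds nothing when A and B are (fractional) ideals,
   as 0 = 0 * a already lies in both. *)
Definition set_mul (A B : set S) : set S :=
  [set x | exists (n : nat) (a b : 'I_n -> S),
     [/\ forall i, A (a i), forall i, B (b i) & x = \sum_(i < n) a i * b i]].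

(* The empty product is S = setT. *)
Definition pi_semiring : Prop :=
  forall a : S, principal a <> [set 0] -> principal a <> setT ->
    exists (n : nat) (P : 'I_n -> set S),
      (forall i, prime_ideal (P i)) /\
      principal a = \big[set_mul/setT]_(i < n) P i.

End Ideals.

Section FractionalIdeals.
Variable S : semidomainType.
Implicit Types A B : set {semifrac S}.

Definition fractional_ideal A : Prop :=
  [/\ A !=set0,
      forall x y, A x -> A y -> A (x + y),
      forall (s : S) x, A x -> A (tosemifrac s * x)
    & exists2 d : S, d != 0 & forall x, A x -> range tosemifrac (tosemifrac d * x)].

Definition invertible A : Prop :=
  exists2 B, fractional_ideal B & set_mul A B = range tosemifrac.

Definition dedekind : Prop :=
  forall A, fractional_ideal A -> A <> [set 0] -> invertible A.

End FractionalIdeals.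

Arguments subtractive S : clear implicits.
Arguments pi_semiring S : clear implicits.
Arguments dedekind S : clear implicits.

(* Main.v *)
(** If every nonzero fractional ideal is invertible, then nonzero ideals satisfy
    the ascending chain condition; a maximal nonzero ideal [I] that is not a
    product of primes would lie in a maximal ideal [M] and be strictly contained
    in [I M^-1], which is a product of primes, hence so would be
    [I = M (I M^-1)].

    Conversely, invertible nonzero primes are maximal: [P] strictly inside a
    prime [Q] gives [P = Q (P Q^-1)], so [P Q^-1] is contained in [P] and
    [Q^-1] in [S]. A nonzero ideal [I] contains a nonzero product [P J] with [P]
    prime and [J] a shorter product of primes. If [I] is contained in [P], then
    [J] is contained in the ideal [I P^-1]; otherwise [I + P = S], and
    [J = (I + P) J] is contained in [I]. By induction, [I] is invertible. *)
Require Import Defs.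
From mathcomp Require Import all_boot all_order all_algebra.
From mathcomp Require Import boolp classical_sets.

Set Implicit Arguments.
Unset Strict Implicit.
Unset Printing Implicit Defensive.

Import GRing.Theory.
Local Open Scope classical_set_scope.
Local Open Scope ring_scope.

Local Notation "A ** B" := (set_mul A B) (at level 40, left associativity).

(** * Products of arbitrary subsets of a semiring *)

Section SetMul.
Variable R : comNzSemiRingType.
Implicit Types A B C : set R.

Lemma mem_set_mul A B a b : A a -> B b -> (A ** B) (a * b).
Proof.
move=> Aa Bb; exists 1%N, (fun=> a), (fun=> b).
by split=> //; rewrite big_ord1.
Qed.

Lemma set_mul0 A B : (A ** B) 0.
Proof. by exists 0%N, (fun=> 0), (fun=> 0); split=> [[]|[]|] //; rewrite big_ord0. Qed.

Lemma set_mulD A B x y : (A ** B) x -> (A ** B) y -> (A ** B) (x + y).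
Proof.
move=> [m [a [b [Aa Bb ->]]]] [n [c [d [Ac Bd ->]]]].
exists (m + n)%N, (fun i => match split i with inl j => a j | inr j => c j end),
  (fun i => match split i with inl j => b j | inr j => d j end).
split=> [i|i|]; try by case: (split i).
rewrite big_split_ord; congr (_ + _); apply: eq_bigr => i _.
  by rewrite -[lshift n i]/(unsplit (inl i)) unsplitK.
by rewrite -[rshift m i]/(unsplit (inr i)) unsplitK.
Qed.

(** A product is the additive closure of elementwise products, so this serves as its induction
    principle. [C] may be any additive condition, for instance one on a fixed multiple of the
    element. *)
Lemma set_mul_sub A B C : C 0 -> (forall x y, C x -> C y -> C (x + y)) ->
  (forall a b, A a -> B b -> C (a * b)) -> A ** B `<=` C.
Proof.
move=> C0 CD CM x [n [a [b [Aa Bb ->]]]].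
by elim/big_ind: _ => // i _; apply: CM.
Qed.

Lemma set_mulS A A' B B' : A `<=` A' -> B `<=` B' -> A ** B `<=` A' ** B'.
Proof.
move=> AA' BB' x [n [a [b [Aa Bb ->]]]]; exists n, a, b.
by split=> // i; [apply: AA' | apply: BB'].
Qed.

Lemma set_mulC : commutative (@set_mul R).
Proof.
have sub A B : A ** B `<=` B ** A.
  apply: set_mul_sub; [exact: set_mul0 | exact: set_mulD |].
  by move=> a b Aa Bb; rewrite mulrC; apply: mem_set_mul.
by move=> A B; apply/seteqP; split.
Qed.

Lemma set_mulA : associative (@set_mul R).
Proof.
have sub A B C : A ** B ** C `<=` A ** (B ** C).
  apply: set_mul_sub; [exact: set_mul0 | exact: set_mulD |] => x c ABx Cc.
  move: x ABx; apply: (set_mul_sub (C := fun x => (A ** (B ** C)) (x * c))).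
  - by rewrite mul0r; apply: set_mul0.
  - by move=> x y; rewrite mulrDl; apply: set_mulD.
  - by move=> a b Aa Bb; rewrite -mulrA; do 2?apply: mem_set_mul.
move=> A B C; apply/seteqP; split; last exact: sub.
(* Commutativity turns the reverse inclusion into [sub] for [C], [B], [A]. *)
by rewrite [A ** (B ** C)]set_mulC [A ** B ** C]set_mulC [A ** B]set_mulC
   [B ** C]set_mulC; apply: sub.
Qed.

End SetMul.

(** * Ideals, Zorn's lemma and products of primes *)

Section Ideals.
Variable R : comNzSemiRingType.
Implicit Types I J M P : set R.

Lemma ideal0 I : ideal I -> I 0.
Proof. by case=> [[a Ia] _ IM]; rewrite -(mul0r a); apply: IM. Qed.

Lemma ideal1 I : ideal I -> I 1 -> I = setT.
Proof.
by case=> _ _ IM I1; apply/seteqP; split=> // x _; rewrite -(mulr1 x); apply: IM.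
Qed.

Lemma ideal_neq0 I : ideal I -> I <> [set 0] -> exists2 a, I a & a != 0.
Proof.
move=> idI I0; apply: contrapT => noa; apply: I0; apply/seteqP; split=> [x Ix|_ ->].
  by apply/eqP/negP => /negP x0; apply: noa; exists x.
exact: ideal0.
Qed.

Lemma ideal_setT : ideal [set: R].
Proof. by split=> //; exists 0. Qed.

Lemma set_mul_ideal I J : ideal I -> ideal (I ** J).
Proof.
move=> [_ ID IM]; split=> [|a b|s]; [by exists 0; apply: set_mul0 | exact: set_mulD |].
apply: (set_mul_sub (C := fun x => (I ** J) (s * x))).
- by rewrite mulr0; apply: set_mul0.
- by move=> x y; rewrite mulrDr; apply: set_mulD.
- by move=> a b Ia Jb; rewrite mulrA; apply: mem_set_mul => //; apply: IM.
Qed.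

Lemma set_mul_idealS I J : ideal J -> I ** J `<=` J.
Proof.
move=> idJ; have [_ JD JM] := idJ.
by apply: set_mul_sub => // [|a b _]; [exact: ideal0 | exact: JM].
Qed.

Lemma ideal_sum I J : ideal I -> ideal J ->
  ideal [set x | exists a b, [/\ I a, J b & x = a + b]].
Proof.
move=> idI idJ; have [_ ID IM] := idI; have [_ JD JM] := idJ; split.
- by exists 0, 0, 0; split; [exact: ideal0 | exact: ideal0 | rewrite addr0].
- move=> _ _ [a [b [Ia Jb ->]]] [c [d [Ic Jd ->]]]; exists (a + c), (b + d).
  by split; [exact: ID | exact: JD | rewrite addrACA].
- move=> s _ [a [b [Ia Jb ->]]]; exists (s * a), (s * b).
  by split; [exact: IM | exact: JM | rewrite mulrDr].
Qed.

Lemma principal_ideal (a : R) : ideal (principal a).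
Proof.
split; first by exists (1 * a), 1.
- by move=> _ _ [s _ <-] [t _ <-]; exists (s + t) => //; rewrite mulrDl.
- by move=> s _ [t _ <-]; exists (s * t) => //; rewrite mulrA.
Qed.

Lemma ideal_bigcup_chain (F : set (set R)) : F !=set0 ->
  (forall I, F I -> ideal I) -> total_on F subset -> ideal (\bigcup_(I in F) I).
Proof.
move=> [I0 FI0] idF totF; split.
- by exists 0; exists I0 => //; exact: (ideal0 (idF _ FI0)).
- move=> a b [I FI Ia] [J FJ Jb].
  have [IJ|JI] := totF _ _ FI FJ.
  + by exists J => //; have [_ JD _] := idF _ FJ; apply: JD => //; apply: IJ.
  + by exists I => //; have [_ ID _] := idF _ FI; apply: ID => //; apply: JI.
- by move=> s a [I FI Ia]; exists I => //; have [_ _ IM] := idF _ FI; apply: IM.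
Qed.

(* [Zorn_bigcup] also asks for the union of the empty chain, which is not an
   ideal; adding [set0] to the family takes care of it. *)
Lemma ideal_Zorn (Q : set (set R)) I : Q I -> (forall J, Q J -> ideal J) ->
  (forall F : set (set R), F !=set0 -> F `<=` Q -> total_on F subset ->
     Q (\bigcup_(J in F) J)) ->
  exists2 M, Q M & forall J, Q J -> M `<=` J -> J = M.
Proof.
move=> QI idQ QF.
have [F FQ totF|M [[QM|M0] maxM]] := @Zorn_bigcup R [set J | Q J \/ J = set0].
- have [[J [FJ QJ]]|noQ] := pselect (exists J, F J /\ Q J); last first.
    right; apply/seteqP; split=> // x [J FJ Jx].
    by case: (FQ _ FJ) => [QJ|J0]; [case: noQ; exists J | move: Jx; rewrite J0].
  left; have -> : \bigcup_(J in F) J = \bigcup_(J in F `&` Q) J.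
    apply/seteqP; split=> x [K]; last by move=> [FK _] Kx; exists K.
    move=> FK Kx; exists K => //; split=> //.
    by case: (FQ _ FK) => // K0; move: Kx; rewrite K0.
  apply: QF; [by exists J | by move=> ? [] |].
  by move=> A B [FA _] [FB _]; apply: totF.
- exists M => // J QJ MJ; apply: contrapT => JM; apply: (maxM J); last by left.
  by split=> // JsM; apply: JM; apply/seteqP.
- case: (maxM I); last by left.
  by rewrite M0; split=> // /(_ 0) I0; apply: I0; exact: (ideal0 (idQ _ QI)).
Qed.

Lemma maximal_ideal_exists I : ideal I -> I <> setT ->
  exists2 M, prime_ideal M & I `<=` M.
Proof.
move=> idI IT.
(* Properness is expressed by the absence of [1], a condition that passes to unions of chains. *)
have [|J []//|F [J FJ] FQ totF|M [idM IM M1] maxM] :=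
    @ideal_Zorn [set J | [/\ ideal J, I `<=` J & ~ J 1]] I.
- by split=> // I1; apply/IT/ideal1.
- split.
  + by apply: ideal_bigcup_chain => //; [exists J | move=> K /FQ[]].
  + by move=> x Ix; exists J => //; have [_ IJ _] := FQ _ FJ; apply: IJ.
  + by move=> [K /FQ[]].
exists M => //; split=> //; first by move=> MT; apply: M1; rewrite MT.
have [_ MD MM] := idM => a b Mab.
have [Ma|Ma] := pselect (M a); [by left | right].
set J := [set x | exists m c, [/\ M m, principal a c & x = m + c]].
have idJ : ideal J by apply: ideal_sum => //; apply: principal_ideal.
have MJ : M `<=` J.
  by move=> m Mm; exists m, 0; split; rewrite ?addr0 //; exact: (ideal0 (principal_ideal _)).
(* If [1 = m + s * a], then [b = m * b + s * (a * b)] lies in [M]. Otherwise maximality forces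
   [J = M], although [J] contains [a]. *)
have [[m [_ [Mm [s _ <-] e]]]|J1] := pselect (J 1).
  by rewrite -(mul1r b) e mulrDl mulrC -mulrA; apply: MD; apply: MM.
case: Ma; rewrite -(maxM J) //; last by split=> // x /IM /MJ.
by exists 0, a; split; [exact: ideal0 | exists 1; rewrite // mul1r | rewrite add0r].
Qed.

(** An inductive form of the indexed products in [pi_semiring], which lets proofs split off one
    prime at a time. *)
Inductive prime_product : set R -> Prop :=
| prime_product1 : prime_product setT
| prime_productM P J : prime_ideal P -> prime_product J -> prime_product (P ** J).

Lemma prime_productP I : prime_product I <->
  exists (n : nat) (P : 'I_n -> set R),
    (forall i, prime_ideal (P i)) /\ I = \big[@set_mul R/setT]_(i < n) P i.
Proof.
split=> [|[n [P [prP ->]]]].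
  elim=> [|P J prP _ [n [Q [prQ ->]]]].
    by exists 0%N, (fun=> setT); split=> [[]|] //; rewrite big_ord0.
  exists n.+1, (fun i => if unlift ord0 i is Some j then Q j else P).
  split=> [i|]; first by case: unliftP.
  rewrite big_ord_recl unlift_none; congr (_ ** _).
  by apply: eq_bigr => i _; rewrite liftK.
elim: n P prP => [|n IHn] P prP; first by rewrite big_ord0; apply: prime_product1.
by rewrite big_ord_recl; apply: prime_productM => //; apply: IHn.
Qed.

Lemma prime_product_ideal I : prime_product I -> ideal I.
Proof.
elim=> [|P J [idP _ _] _ _]; first exact: ideal_setT.
exact: set_mul_ideal.
Qed.

End Ideals.

(** * Fractional ideals and the embedding of [S] in its semifield of fractions *)

Section FractionalIdeals.
Variable S : semidomainType.
Implicit Types (A B C : set {semifrac S}) (I J M P Q : set S).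

Local Notation t := (@tosemifrac S).
Local Notation O := (range t).

Lemma fractional0 A : fractional_ideal A -> A 0.
Proof. by case=> [[a Aa] _ AM _]; rewrite -(mul0r a) -(rmorph0 t); apply: AM. Qed.

Lemma set_mul1 A : fractional_ideal A -> O ** A = A.
Proof.
move=> fA; have [_ AD AM _] := fA; apply/seteqP; split.
  apply: set_mul_sub => //; first exact: fractional0.
  by move=> _ a [s _ <-] Aa; apply: AM.
by move=> a Aa; rewrite -(mul1r a); apply: mem_set_mul => //; exists 1; rewrite ?rmorph1.
Qed.

Lemma ideal_fractional I : ideal I -> fractional_ideal (t @` I).
Proof.
move=> [[a Ia] ID IM]; split.
- by exists (t a), a.
- by move=> _ _ [x Ix <-] [y Iy <-]; exists (x + y); [exact: ID | rewrite rmorphD].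
- by move=> s _ [x Ix <-]; exists (s * x); [exact: IM | rewrite rmorphM].
- exists 1 => [|_ [x _ <-]]; first exact: oner_neq0.
  by exists x => //; rewrite rmorph1 mul1r.
Qed.

Lemma range_fractional : fractional_ideal O.
Proof. exact/ideal_fractional/ideal_setT. Qed.

Lemma preimage_ideal A : fractional_ideal A -> ideal (t @^-1` A).
Proof.
move=> fA; have [_ AD AM _] := fA; split.
- by exists 0; rewrite /= rmorph0; apply: fractional0.
- by move=> a b Aa Ab; rewrite /= rmorphD; apply: AD.
- by move=> s a Aa; rewrite /= rmorphM; apply: AM.
Qed.

Lemma image_preimage_range A : A `<=` O -> t @` (t @^-1` A) = A.
Proof.
move=> AO; apply/seteqP; split=> [_ [x Ax <-]//|y Ay].
by have [x _ xy] := AO _ Ay; exists x; rewrite //= xy.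
Qed.

Lemma image_tosemifrac_inj I J : t @` I = t @` J -> I = J.
Proof.
have sub I' J' : t @` I' = t @` J' -> I' `<=` J'.
  move=> e x Ix; have: (t @` J') (t x) by rewrite -e; exists x.
  by case=> y Jy /(@tosemifrac_inj S) <-.
by move=> e; apply/seteqP; split; apply: sub.
Qed.

Lemma image_set_mul I J : t @` (I ** J) = (t @` I) ** (t @` J).
Proof.
apply/seteqP; split=> [_ [x IJx <-]|].
  move: x IJx; apply: (set_mul_sub (C := fun x => ((t @` I) ** (t @` J)) (t x))).
  - by rewrite rmorph0; apply: set_mul0.
  - by move=> x y; rewrite rmorphD; apply: set_mulD.
  - by move=> a b Ia Jb; rewrite rmorphM; apply: mem_set_mul; [exists a | exists b].
apply: set_mul_sub.
- by exists 0; [exact: set_mul0 | rewrite rmorph0].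
- move=> _ _ [x IJx <-] [y IJy <-].
  by exists (x + y); [exact: set_mulD | rewrite rmorphD].
- move=> _ _ [a Ia <-] [b Jb <-].
  by exists (a * b); [exact: mem_set_mul | rewrite rmorphM].
Qed.

Lemma set_mul_fractional A B :
  fractional_ideal A -> fractional_ideal B -> fractional_ideal (A ** B).
Proof.
move=> [_ _ AM [d d0 dA]] [_ _ _ [e e0 eB]]; split.
- by exists 0; apply: set_mul0.
- by move=> x y; apply: set_mulD.
- move=> s; apply: (set_mul_sub (C := fun x => (A ** B) (t s * x))).
  + by rewrite mulr0; apply: set_mul0.
  + by move=> x y; rewrite mulrDr; apply: set_mulD.
  + by move=> a b Aa Bb; rewrite mulrA; apply: mem_set_mul => //; apply: AM.
- exists (d * e); first exact: semidomain_mulf_neq0.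
  apply: (set_mul_sub (C := fun x => O (t (d * e) * x))).
  + by exists 0; rewrite // mulr0 rmorph0.
  + by move=> x y [u _ ux] [v _ vy]; exists (u + v); rewrite // mulrDr -ux -vy rmorphD.
  + move=> a b /dA[u _ ua] /eB[v _ vb]; exists (u * v) => //.
    by rewrite !rmorphM /= ua vb mulrACA.
Qed.

Lemma invertible_range : invertible O.
Proof. by exists O; [|rewrite set_mul1 //]; apply: range_fractional. Qed.

Lemma invertible_set_mul A B : invertible A -> invertible B -> invertible (A ** B).
Proof.
move=> [A' fA' AA'] [B' fB' BB']; exists (A' ** B'); first exact: set_mul_fractional.
rewrite [A' ** _]set_mulC set_mulA -(set_mulA A) BB' (set_mulC A).
by rewrite -set_mulA AA' set_mul1 //; apply: range_fractional.
Qed.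

(** To contain is to divide: with [B] inverse to [M], the product [I B] lies in [M B = S], so it
    comes from an ideal [J] of [S], and [M J = M B I = I]. *)
Lemma invertible_factor I M : ideal I -> ideal M -> I `<=` M ->
  invertible (t @` M) -> exists J B,
  [/\ ideal J, fractional_ideal B, (t @` M) ** B = O, t @` J = (t @` I) ** B
    & I = M ** J].
Proof.
move=> idI idM IM [B fB MB].
have fI := ideal_fractional idI; have fM := ideal_fractional idM.
have IBO : (t @` I) ** B `<=` O by rewrite -MB; apply: set_mulS => //; apply: image_subset.
have tJ := image_preimage_range IBO.
exists (t @^-1` ((t @` I) ** B)), B; split=> //.
  exact/preimage_ideal/set_mul_fractional.
apply: image_tosemifrac_inj.
by rewrite image_set_mul tJ [_ @` I ** B]set_mulC set_mulA MB set_mul1.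
Qed.

(** * Semidomains whose nonzero primes are invertible *)

Section PrimesInvertible.
Hypothesis prime_invertible :
  forall P, prime_ideal P -> P <> [set 0] -> invertible (t @` P).

Lemma nonzero_prime_maximal P I : prime_ideal P -> P <> [set 0] ->
  ideal I -> P `<=` I -> I <> setT -> I `<=` P.
Proof.
move=> prP P0 idI PI IT; have [Q prQ IQ] := maximal_ideal_exists idI IT.
have [idP _ prime_P] := prP; have [idQ QT _] := prQ.
apply: (subset_trans IQ); apply: contrapT => QP.
have [a Pa a0] := ideal_neq0 idP P0.
have PQ : P `<=` Q by apply: subset_trans IQ.
have Q0 : Q <> [set 0].
  by move=> Q0; move/PQ: Pa; rewrite Q0 /= => /eqP; apply/negP.
have [J [B [idJ fB QB tJ ePQJ]]] :=
  invertible_factor idP idQ PQ (prime_invertible prQ Q0).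
have JP : J `<=` P.
  (* Some [q] in [Q] avoids [P]; since [q * j] lies in [Q J = P], primality puts [j] in [P]. *)
  move/existsNP: QP => [q /not_implyP[Qq Pq]] j Jj.
  by case: (prime_P q j) => //; rewrite ePQJ; apply: mem_set_mul.
have [P' fP' PP'] := prime_invertible prP P0.
(* Here [B = P' P B = P' J], which lies in [P' P = S]. *)
have BO : B `<=` O.
  rewrite -PP' -(set_mul1 fB) -PP' -set_mulA [P' ** B]set_mulC set_mulA -tJ.
  by apply: set_mulS => //; apply: image_subset.
apply: QT; apply: ideal1 => //.
suff [x Qx /(@tosemifrac_inj S) <-] : (t @` Q) (t 1) by [].
(* Since [B] lies in [S], the element [1] of [Q B] lies in [Q S = Q]. *)
rewrite -(set_mul1 (ideal_fractional idQ)) set_mulC.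
have : ((t @` Q) ** B) (t 1) by rewrite QB; exists 1.
by apply: set_mulS.
Qed.

(** The induction on [J] keeps [I] general, because splitting off a prime that contains [I] replaces
    [I] by its cofactor. *)
Lemma prime_product_sub_invertible I J : prime_product J -> J <> [set 0] ->
  ideal I -> J `<=` I -> invertible (t @` I).
Proof.
move=> ppJ; elim: ppJ I => [|P {}J prP ppJ IH] I PJ0 idI sub.
  have -> : I = setT by apply/seteqP; split.
  exact: invertible_range.
have idJ := prime_product_ideal ppJ; have [idP _ _] := prP.
have set_mul_neq0 x y : P x -> J y -> x * y != 0 -> P ** J <> [set 0].
  by move=> Px Jy xy0 e; have := mem_set_mul Px Jy; rewrite e => /eqP; apply/negP.
have [J0 P0] : J <> [set 0] /\ P <> [set 0].
  have idPJ := set_mul_ideal J idP; have [x PJx x0] := ideal_neq0 idPJ PJ0.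
  split=> e0; move: PJx x0.
    by move/(set_mul_idealS idJ); rewrite e0 => ->; rewrite eqxx.
  by rewrite set_mulC => /(set_mul_idealS idP); rewrite e0 => ->; rewrite eqxx.
have invP := prime_invertible prP P0.
have [IP|nIP] := pselect (I `<=` P).
  have [K [B [idK fB PB tK ->]]] := invertible_factor idI idP IP invP.
  rewrite image_set_mul; apply: invertible_set_mul => //; apply: IH => // x Jx.
  suff [y Ky /(@tosemifrac_inj S) <-] : (t @` K) (t x) by [].
  (* Multiplying [P J], a subset of [I], by the inverse [B] of [P] gives [J] on one side and
     [I B = K] on the other. *)
  have : (B ** (t @` (P ** J))) (t x).
    rewrite image_set_mul set_mulA [B ** _]set_mulC PB set_mul1; first by exists x.
    exact: ideal_fractional.
  by rewrite tK set_mulC; apply: set_mulS => //; apply: image_subset.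
set IP := [set x | exists a b, [/\ I a, P b & x = a + b]].
have idIP : ideal IP by apply: ideal_sum.
(* Were [I + P] proper, maximality of [P] would give [I + P], hence [I], inside [P]. *)
have IPT : IP = setT.
  apply: contrapT => IPT; apply: nIP => x Ix.
  apply: (nonzero_prime_maximal prP P0 idIP _ IPT) => [y Py|].
    by exists 0, y; split; [exact: ideal0 | | rewrite add0r].
  by exists x, 0; split; [| exact: ideal0 | rewrite addr0].
have [i [p [Ii Pp e1]]] : IP 1 by rewrite IPT.
apply: IH => // x Jx; have [_ ID IM] := idI.
rewrite -(mul1r x) e1 mulrDl; apply: ID; first by rewrite mulrC; apply: IM.
exact/sub/mem_set_mul.
Qed.

End PrimesInvertible.

(** * Dedekind semidomains: reduction to ideals of [S], and prime factorization *)

Lemma ideals_invertible_dedekind :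
  (forall I, ideal I -> I <> [set 0] -> invertible (t @` I)) -> dedekind S.
Proof.
(* Clearing denominators turns [A] into an ideal [d A] of [S]; if [B] inverts [d A], then [d B]
   inverts [A]. *)
move=> inv A fA A0; have [_ AD AM [d d0 dA]] := fA.
have fD : fractional_ideal (t @` principal d).
  exact/ideal_fractional/principal_ideal.
have DAO : (t @` principal d) ** A `<=` O.
  apply: set_mul_sub.
  - exact: (fractional0 range_fractional).
  - by have [_ + _ _] := range_fractional.
  - move=> _ a [_ [s _ <-] <-] Aa; rewrite rmorphM -mulrA.
    by have [_ _ + _] := range_fractional; apply; apply: dA.
have fDA := set_mul_fractional fD fA.
have := inv _ (preimage_ideal fDA); rewrite image_preimage_range //.
case=> [e0|B fB DAB].
  (* If [d A] is zero, multiplying by the inverse [y] of [d] shows that [A] is zero too. *)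
  apply: A0; apply/seteqP; split=> [a Aa|_ ->]; last exact: fractional0.
  have := mem_set_mul (A := t @` principal d) (a := t d) _ Aa.
  move=> /(_ _)/wrap[]; first by exists d => //; exists 1; rewrite // mul1r.
  move=> DAa; have [x _ xda] := DAO _ DAa.
  have [y yd] := tosemifrac_unit d0.
  have x0 : x = 0 by have : [set 0] x by rewrite -e0 /= xda.
  by rewrite /= -(mul1r a) -yd -mulrA -xda x0 rmorph0 mulr0.
exists (t @` principal d ** B); first exact: set_mul_fractional.
by rewrite set_mulA (set_mulC A).
Qed.

(** Invertible ideals are finitely generated: [1 = \sum a i * b i] gives [x = \sum (x * b i) * a i]
    with each [x * b i] in [S]. One member of the chain contains all the generators [a i], hence the
    whole union. *)
Lemma invertible_bigcup_chain (F : set (set S)) : F !=set0 ->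
  (forall I, F I -> ideal I) -> total_on F subset ->
  invertible (t @` (\bigcup_(I in F) I)) -> F (\bigcup_(I in F) I).
Proof.
move=> [I0 FI0] idF totF [B fB UB]; set U := \bigcup_(I in F) I in UB *.
have [n [a [b [Ua Bb e1]]]] : ((t @` U) ** B) 1 by rewrite UB; exists 1; rewrite ?rmorph1.
have [X FX aX] : exists2 X, F X & forall i, (t @` X) (a i).
  (* Each new index keeps the larger of two members of the chain. *)
  have: forall s : seq 'I_n, exists2 X, F X & forall i, i \in s -> (t @` X) (a i).
    elim=> [|i s [X FX aX]]; first by exists I0.
    have [x [Y FY Yx] xa] := Ua i.
    have [XY|YX] := totF _ _ FX FY.
      exists Y => // j; rewrite inE => /predU1P[->|/aX[z /XY Yz <-]]; last by exists z.
      by exists x.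
    exists X => // j; rewrite inE => /predU1P[->|/aX//].
    by exists x => //; apply: YX.
  by move=> /(_ (index_enum 'I_n))[X FX aX]; exists X => // i; apply/aX/mem_index_enum.
suff -> : U = X by [].
apply/seteqP; split=> [x Ux|x Xx]; last by exists X.
suff [y Xy /(@tosemifrac_inj S) <-] : (t @` X) (t x) by [].
have fX := ideal_fractional (idF _ FX); have [_ XD XM _] := fX.
rewrite -(mul1r (t x)) e1 mulr_suml; elim/big_ind: _ => [|//|i _].
  exact: fractional0.
have [s _ sxb] : O (t x * b i) by rewrite -UB; apply: mem_set_mul => //; exists x.
by rewrite -mulrA [b i * _]mulrC -sxb mulrC; apply: XM.
Qed.

Lemma dedekind_prime_product I :
  dedekind S -> ideal I -> I <> [set 0] -> prime_product I.
Proof.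
move=> ded idI I0; apply: contrapT => ppI.
have inv J : ideal J -> J <> [set 0] -> invertible (t @` J).
  move=> idJ J0; apply: ded; first exact: ideal_fractional.
  by move=> e; apply/J0/image_tosemifrac_inj; rewrite e image_set1 rmorph0.
have neq0S J K : ideal J -> J <> [set 0] -> J `<=` K -> K <> [set 0].
  move=> idJ J0 JK K0; have [x Jx] := ideal_neq0 idJ J0.
  by move/JK: Jx; rewrite K0 => ->; rewrite eqxx.
have [//|J []//|F [J FJ] FQ totF|{idI I0 ppI}I [idI I0 ppI] maxI] :=
    @ideal_Zorn _ [set J | [/\ ideal J, J <> [set 0] & ~ prime_product J]] I.
  have [idJ J0 _] := FQ _ FJ; have idF K : F K -> ideal K by move=> /FQ[].
  (* The union is nonzero, hence invertible, so it is itself a member of the chain and inherits its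
     properties. *)
  apply: FQ; apply: invertible_bigcup_chain => //; first by exists J.
  apply: inv; first by apply: ideal_bigcup_chain => //; exists J.
  by apply: (neq0S J) => // x Jx; exists J.
have [|M prM IM] := maximal_ideal_exists idI.
  by move=> IT; apply: ppI; rewrite IT; apply: prime_product1.
have [idM MT _] := prM.
have [J [B [idJ fB MB tJ eI]]] :=
  invertible_factor idI idM IM (inv M idM (neq0S _ _ idI I0 IM)).
have IJ : I `<=` J by rewrite eI; apply: set_mul_idealS.
apply: ppI; rewrite eI; apply: prime_productM => //; apply: contrapT => ppJ.
have eJI : J = I by apply: maxI => //; split=> //; apply: (neq0S I).
have [I' fI' II'] := inv I idI I0.
(* Now [I = I B]; cancelling the invertible [I] gives [B = S], whence [M = M B = S], a
   contradiction. *)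
have B1 : B = O.
  by rewrite -(set_mul1 fB) -II' [_ ** I']set_mulC -set_mulA -tJ eJI.
apply/MT/image_tosemifrac_inj.
by rewrite -MB B1 set_mulC set_mul1 //; apply: ideal_fractional.
Qed.

End FractionalIdeals.

Theorem theorem3p32 (S : semidomainType) (hS : subtractive S) :
  dedekind S <->
  (forall P : set S, prime_ideal P -> P <> [set 0%R]%classic ->
     invertible (tosemifrac @` P)%classic) /\
  pi_semiring S.
Proof.
split=> [ded|[prime_inv piS]].
  split=> [P [idP _ _] P0|a a0 _].
    apply: ded; first exact: ideal_fractional.
    by move=> e; apply/P0/image_tosemifrac_inj; rewrite e image_set1 rmorph0.
  apply/prime_productP/dedekind_prime_product => //; exact: principal_ideal.
apply: ideals_invertible_dedekind => I idI I0.
have [a Ia a0] := ideal_neq0 idI I0.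
have aI : principal a `<=` I by move=> _ [s _ <-]; have [_ _] := idI; apply.
have pa0 : principal a <> [set 0].
  move=> e; have : principal a a by exists 1; rewrite // mul1r.
  by rewrite e => /eqP; apply/negP.
apply: (prime_product_sub_invertible prime_inv _ pa0 idI aI).
(* [pi_semiring] covers only proper principal ideals; when [a] is a unit, the empty product
   serves. *)
have [->|paT] := pselect (principal a = setT); first exact: prime_product1.
exact/prime_productP/piS.
Qed.
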